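(* Let $X$ be a real Banach space, let $f: X \to \mathbb{R}\cup\{+\infty\}$ be a proper lower semicontinuous convex function, let $\lambda>0$ and $\ell\ge 0$. If $f$ is $\ell$-Lipschitz on $\operatorname{dom}f$, then its Moreau envelope $f_\lambda$ is $\ell$-Lipschitz on $\operatorname{dom}f$.
   Context: For $f:X\to\mathbb{R}\cup\{+\infty\}$, $\operatorname{dom}f=\{x\in X: f(x)\in\mathbb{R}\}$; $f$ is proper if $\operatorname{dom} f\neq\emptyset$, convex (resp. lower semicontinuous) if its epigraph $\{(x,r)\in X\times\mathbb{R}: f(x)\le r\}$ is convex (resp. closed in $X\times\mathbb{R}$). A function is $\ell$-Lipschitz on a nonempty set $S\subset X$ if it is finite on $S$ and $|f(x)-f(y)|\le \ell\|x-y\|$ for all $x,y\in S$. For $\lambda>0$, the Moreau envelope of $f$ of index $\lambda$ is $f_\lambda(x):=\inf\left\{f(y)+\frac{\|x-y\|^2}{2\lambda}:y\in X\right\}$ for $x\in X$. *)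

(* Defs.v *)
From HB Require Import structures.
From mathcomp Require Import all_boot all_order all_algebra.
From mathcomp Require Import all_classical all_reals all_analysis.

Set Implicit Arguments.
Unset Strict Implicit.
Unset Printing Implicit Defensive.

Import Order.TTheory GRing.Theory Num.Theory.
Import numFieldNormedType.Exports.

Local Open Scope classical_set_scope.
Local Open Scope ring_scope.

Section ExtendedRealFunctions.
Context {R : realType} {X : normedModType R}.
Implicit Types (f g : X -> \bar R) (S : set X).

Definition edom f : set X := [set x | f x \is a fin_num].

Definition epigraph f : set (X * R^o) := [set p | (f p.1 <= p.2%:E)%E].

Definition proper_fun f : Prop := edom f !=set0.

Definition convex_fun f : Prop := convex_set (epigraph f).

Definition lsc_fun f : Prop := closed (epigraph f).

(* [fine] sends the infinite values to 0, hence the explicit finiteness. *)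
Definition elipschitz_on (l : R) S g : Prop :=
  (forall x, S x -> g x \is a fin_num) /\ l.-lipschitz_S (fine \o g : X -> R^o).

Definition moreau_envelope (lambda : R) f (x : X) : \bar R :=
  ereal_inf [set (f y + (`|x - y| ^+ 2 / (2 * lambda))%:E)%E | y in [set: X]].

End ExtendedRealFunctions.

(* Main.v *)
Require Import Defs.
From HB Require Import structures.
From mathcomp Require Import all_boot all_order all_algebra.
From mathcomp Require Import all_classical all_reals all_analysis.
From mathcomp Require Import ring lra.
Import Order.TTheory GRing.Theory Num.Theory.
Import numFieldNormedType.Exports.
Local Open Scope classical_set_scope.
Local Open Scope ring_scope.
Local Open Scope convex_scope.

(** Let [x], [x'], [z] be points of [edom f], where [z] competes in the
    infimum that defines the envelope at [x'].  If [z] lies within [lambda * l]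
    of [x], it competes nearly as well at [x], because [t ^+ 2 / (2 * lambda)]
    has slope at most [l] for [t <= lambda * l].  If [z] is further away, the
    quadratic penalty grows faster than [f] can decrease, so it pays to move [z]
    towards [x] along the segment until the distance is [lambda * l]: the point
    [y] reached is in [edom f] by convexity, and [f] increases by at most
    [l * `|y - z|].  In both cases the value of [y] at [x] exceeds the value of
    [z] at [x'] by at most [l * `|x - x'|] ([moreau_competitor]).  Taking infima
    gives one half of the Lipschitz inequality, and the other by symmetry.

    Behind this is the fact that the envelope of [f] agrees on [edom f] with
    the envelope of the largest [l]-Lipschitz extension of [f], that is, with
    the infimal convolution of [f] with the Huber function of the norm, which
    inherits the constant [l] from that function. *)

Lemma segment_point_at_dist {R : realType} {X : normedModType R} {x z : X}
    {r : R} : 0 <= r <= `|x - z| ->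
  exists2 t : {i01 R}, `|x - (z : convex_lmodType X) <| t |> x| = r &
    `|(z : convex_lmodType X) <| t |> x - z| = `|x - z| - r.
Proof.
move=> /andP[r0 rxz].
have [xz|xz] := eqVneq `|x - z| 0.
  have {rxz}r0 : r = 0 by apply/le_anti; rewrite r0 -xz rxz.
  by exists 1%:i01; rewrite conv1 r0 ?subrr ?normr0 ?subr0.
have xz0 : 0 < `|x - z| by rewrite lt_neqAle eq_sym xz normr_ge0.
have s0 : 0 <= r / `|x - z| by rewrite divr_ge0.
have s1 : r / `|x - z| <= 1 by rewrite ler_pdivrMr// mul1r.
have rE : r / `|x - z| * `|x - z| = r by rewrite divfK.
exists (Itv01 s0 s1); rewrite /conv /= /unstable.onem.
  rewrite scalerBl scale1r addrCA opprD addrA subrr add0r opprB -scalerBr.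
  by rewrite normrZ ger0_norm.
have -> (u : R) : u *: z + (1 - u) *: x - z = (1 - u) *: (x - z).
  by rewrite scalerBr [X in _ = _ - X]scalerBl scale1r opprB addrAC addrC.
by rewrite normrZ ger0_norm ?subr_ge0// mulrBl mul1r rE.
Qed.

(** The Huber function, which is [t ^+ 2 / (2 * lambda)] up to
    [t = lambda * l] and continues with slope [l] beyond, is nondecreasing,
    [l]-Lipschitz and below the quadratic; the left-hand side is its value at
    [t = a]. *)
Lemma huber_le_quadratic {R : realFieldType} {lambda l a b d : R} :
    0 < lambda -> 0 <= l -> 0 <= a -> 0 <= b -> 0 <= d -> a <= b + d ->
  let r := Num.min a (lambda * l) in
  l * (a - r) + r ^+ 2 / (2 * lambda) <= b ^+ 2 / (2 * lambda) + l * d.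
Proof.
move=> lam0 l0 a0 b0 d0 abd /=.
have lam20 : 0 < 2 * lambda by rewrite mulr_gt0.
rewrite -(ler_pM2r lam20) !(mulrDl _ _ (2 * lambda)) !divfK ?gt_eqF//.
have m0 : 0 <= lambda * l by rewrite mulr_ge0// ltW.
have lE k : l * k * (2 * lambda) = 2 * (lambda * l) * k by ring.
rewrite !lE.
move: (lambda * l) m0 => m m0.
case: (leP a m) => am.
  rewrite subrr mulr0 add0r.
  have md0 : 0 <= m * d by rewrite mulr_ge0.
  have [ab|ba] := leP a b.
    by have := lerXn2r 2 a0 b0 ab; lra.
  have h1 : 0 <= (b + d - a) * (a + b) by rewrite mulr_ge0; lra.
  have h2 : 0 <= d * (2 * m - a - b) by rewrite mulr_ge0; lra.
  lra.
have := sqr_ge0 (b - m).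
have : 0 <= m * (b + d - a) by rewrite mulr_ge0 ?subr_ge0.
lra.
Qed.

Section Envelope.
Context {R : realType} {X : normedModType R}.
Context {f : X -> \bar R} {lambda l : R}.
Hypotheses (f_ninfty : forall x, f x <> -oo%E) (f_convex : convex_fun f).

(** A convex combination of points of the graph of [f] lies in the epigraph,
    which bounds [f] above by a real number there. *)
Lemma edom_convex {x y : convex_lmodType X} (t : {i01 R}) :
  edom f x -> edom f y -> edom f (x <| t |> y).
Proof.
move=> fx fy.
have := @f_convex (x, fine (f x)) (y, fine (f y)) t.
rewrite !inE /epigraph /= !fineK// => /(_ (lexx _) (lexx _)) h.
rewrite /edom /= fin_numE; apply/andP; split; first exact/eqP/f_ninfty.
by rewrite -ltey (le_lt_trans h)// ltry.
Qed.

Hypotheses (lambda_gt0 : 0 < lambda) (l_ge0 : 0 <= l).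
Hypothesis f_lip : elipschitz_on l (edom f) f.

Lemma edom_lip {x y} : edom f x -> edom f y ->
  fine (f x) - fine (f y) <= l * `|x - y|.
Proof.
move=> fx fy; apply: le_trans (ler_norm _) _.
by case: f_lip => _ /(_ (x, y)) /=; apply.
Qed.

Lemma moreau_competitor {x} x' {z} : edom f x -> edom f z ->
  exists2 y, edom f y &
    fine (f y) + `|x - y| ^+ 2 / (2 * lambda) <=
    fine (f z) + `|x' - z| ^+ 2 / (2 * lambda) + l * `|x - x'|.
Proof.
(* Stopping at distance [t] from [x] on the way from [z] costs at most
   [l * (`|x - z| - t) + t ^+ 2 / (2 * lambda)] more than [fine (f z)];
   [r] minimizes this bound over [0 <= t <= `|x - z|]. *)
move=> fx fz; set r := Num.min `|x - z| (lambda * l).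
have r_itv : 0 <= r <= `|x - z|.
  by rewrite le_min normr_ge0 mulr_ge0 ?(ltW lambda_gt0)//= ge_min lexx.
have [t xy yz] := segment_point_at_dist r_itv.
have fy := edom_convex t fz fx.
exists ((z : convex_lmodType X) <| t |> x) => //.
have := edom_lip fy fz; rewrite xy yz => fyz.
have dist : `|x - z| <= `|x' - z| + `|x - x'|.
  by rewrite [leRHS]addrC ler_distD.
have := huber_le_quadratic lambda_gt0 l_ge0 (normr_ge0 _)
  (normr_ge0 _) (normr_ge0 _) dist.
rewrite -/r /=; lra.
Qed.

Lemma moreau_le x {y} : edom f y ->
  (moreau_envelope lambda f x <=
    (fine (f y) + `|x - y| ^+ 2 / (2 * lambda))%:E)%E.
Proof.
move=> fy; apply: ereal_inf_lbound; exists y => //.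
by rewrite EFinD fineK.
Qed.

Lemma le_moreau {c x} :
    (forall y, edom f y -> c <= fine (f y) + `|x - y| ^+ 2 / (2 * lambda)) ->
  (c%:E <= moreau_envelope lambda f x)%E.
Proof.
move=> c_le; apply: le_ereal_inf_tmp => _ [y _ <-].
have [fy|fy] := boolP (f y \is a fin_num).
  by rewrite -(fineK fy) -EFinD lee_fin c_le.
have -> : f y = +oo%E by case: (f y) (f_ninfty y) fy.
by rewrite addye// leey.
Qed.

Lemma moreau_fin {x} : edom f x -> moreau_envelope lambda f x \is a fin_num.
Proof.
move=> fx; rewrite fin_numE -ltNye -ltey; apply/andP; split; last first.
  exact: le_lt_trans (moreau_le x fx) (ltry _).
(* [- l * t + t ^+ 2 / (2 * lambda)] is minimal at [t = lambda * l] *)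
apply: lt_le_trans (ltNyr (fine (f x) - lambda * l ^+ 2 / 2)) _.
apply: le_moreau => y fy.
have := edom_lip fx fy; set t := `|x - y| => fxy.
have lam20 : 0 < 2 * lambda by rewrite mulr_gt0.
suff : l * t - lambda * l ^+ 2 / 2 <= t ^+ 2 / (2 * lambda) by lra.
rewrite ler_pdivlMr//; have := sqr_ge0 (t - lambda * l); nra.
Qed.

Lemma moreau_sub_le {x x'} : edom f x -> edom f x' ->
  fine (moreau_envelope lambda f x) - fine (moreau_envelope lambda f x') <=
    l * `|x - x'|.
Proof.
move=> fx fx'; rewrite lerBlDr -lerBlDl -lee_fin fineK ?moreau_fin//.
apply: le_moreau => z fz; have [y fy yz] := moreau_competitor x' fx fz.
rewrite lerBlDr; apply: le_trans yz.
by rewrite -lee_fin fineK ?moreau_fin// moreau_le.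
Qed.

End Envelope.

Theorem theorem5p2 (R : realType) (X : completeNormedModType R)
  (f : X -> \bar R) (lambda l : R)
  (f_ninfty : forall x, f x <> -oo%E)
  (f_proper : proper_fun f)
  (f_lsc : lsc_fun f)
  (f_convex : convex_fun f)
  (lambda_gt0 : 0 < lambda)
  (l_ge0 : 0 <= l)
  (f_lip : elipschitz_on l (edom f) f) :
  elipschitz_on l (edom f) (moreau_envelope lambda f).
Proof.
split=> [x fx|[x y] /= [fx fy]].
  exact: (moreau_fin f_ninfty lambda_gt0 f_lip fx).
rewrite ler_norml lerNl opprB; apply/andP; split.
  by rewrite distrC; exact: (moreau_sub_le f_ninfty).
exact: (moreau_sub_le f_ninfty).
Qed.
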